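(* Let $\mathcal G$ be a network as in the context, let $Y$ be a subspace of $\mathbb C^{4E}$ and $R$ a (not necessarily self-adjoint) linear operator on $Y$. Consider the sesquilinear form $$\mathfrak a(u,v)=\sum_{\mathsf e\in\mathsf E}\int_0^{\ell_{\mathsf e}}u_{\mathsf e}''(x)\overline{v_{\mathsf e}''(x)}\,dx-\left(R{\bf u}^{0,1},{\bf v}^{0,1}\right)_{\mathbb C^{4E}}$$ with domain $D(\mathfrak a)=\widetilde H^2_Y(\mathcal G):=\{u\in\widetilde H^2(\mathcal G):{\bf u}^{0,1}\in Y\}$. Then the operator on $L^2(\mathcal G)$ associated with $\mathfrak a$ is $A_{Y,R}$, i.e. the edgewise fourth derivative $u\mapsto(u_{\mathsf e}'''')_{\mathsf e}$ with domain $D(A_{Y,R})=\{u\in\widetilde H^4(\mathcal G):{\bf u}^{0,1}\in Y,\ {\bf u}^{3,2}+R{\bf u}^{0,1}\in Y^\perp\}$.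
   Context: Let $\mathsf G=(\mathsf V,\mathsf E)$ be a finite connected graph without loops or multiple edges, $E=|\mathsf E|$. Fix an orientation; each edge $\mathsf e$ is identified with $[0,\ell_{\mathsf e}]$, $\ell_{\mathsf e}>0$, initial endpoint $\leftrightarrow0$, terminal endpoint $\leftrightarrow\ell_{\mathsf e}$, giving the network $\mathcal G$. $L^2(\mathcal G)=\bigoplus_{\mathsf e}L^2(0,\ell_{\mathsf e})$, $\widetilde H^k(\mathcal G)=\bigoplus_{\mathsf e}H^k(0,\ell_{\mathsf e})$. With $u(0)=(u_{\mathsf e}(0))_{\mathsf e}$, $u(\ell)=(u_{\mathsf e}(\ell_{\mathsf e}))_{\mathsf e}$ (similarly for derivatives), ${\bf u}^{0,1}=(u(0),u(\ell),-u'(0),u'(\ell))\in\mathbb C^{4E}$ and ${\bf u}^{3,2}=(-u'''(0),u'''(\ell),-u''(0),-u''(\ell))\in\mathbb C^{4E}$. The operator $S$ associated with a form $\mathfrak a$ is defined by $D(S)=\{u\in D(\mathfrak a):\exists v\in L^2(\mathcal G)\text{ with }\mathfrak a(u,h)=(v,h)_{L^2}\ \forall h\in D(\mathfrak a)\}$, $Su=v$. *)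

(* Defs.v *)
From HB Require Import structures.
From mathcomp Require Import all_boot all_order all_algebra.
From mathcomp Require Import all_classical all_reals.
From mathcomp Require Import topology normedtype sequences measure lebesgue_measure lebesgue_integral.
From mathcomp Require Import complex.

Set Implicit Arguments.
Unset Strict Implicit.
Unset Printing Implicit Defensive.

Import Order.TTheory GRing.Theory Num.Theory.
Local Open Scope classical_set_scope.
Local Open Scope ring_scope.

(* Scalars: C := R[i] for R : realType. *)

Section Network.
Variable R : realType.
Local Notation C := (R[i]).
Local Notation mu := (@lebesgue_measure R).

(* ---------- The underlying graph ---------- *)
(* Edges are 'I_E ; edge e goes from vertex src e (endpoint 0) to tgt e
   (endpoint ell e).  The orientation is fixed by src/tgt. *)
Definition graph_adj (V : finType) (E : nat) (src tgt : 'I_E -> V) : rel V :=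
  fun x y => [exists e, ((src e == x) && (tgt e == y)) || ((src e == y) && (tgt e == x))].

Definition simple_connected_graph (V : finType) (E : nat) (src tgt : 'I_E -> V) : Prop :=
  (* no loops *)
  (forall e, src e != tgt e) /\
  (* no multiple edges (also no antiparallel pair) *)
  (forall e e', ((src e == src e') && (tgt e == tgt e')) ||
                ((src e == tgt e') && (tgt e == src e')) -> e = e') /\
  (* nonempty and connected *)
  (0 < #|V|)%N /\ (forall x y : V, connect (graph_adj src tgt) x y).

(* ---------- Complex-valued integration on [a,b] ---------- *)
Definition itv (a b : R) : set R := `[a, b].

Definition cint (a b : R) (f : R -> C) : C :=
  Complex (Rintegral mu `[a, b] (fun x => complex.Re (f x)))
          (Rintegral mu `[a, b] (fun x => complex.Im (f x))).

Definition normsq (z : C) : R := complex.Re z ^+ 2 + complex.Im z ^+ 2.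

(* f belongs to L^2(0,l) *)
Definition L2 (l : R) (f : R -> C) : Prop :=
  measurable_fun `[0, l] (fun x => complex.Re (f x)) /\
  measurable_fun `[0, l] (fun x => complex.Im (f x)) /\
  (\int[mu]_(x in itv 0 l) ((normsq (f x))%:E) < +oo)%E.

(* H^k(0,l): d 0 is (the continuous representative of) the function and
   d j is its j-th derivative; d 0,...,d (k-1) are absolutely continuous
   on [0,l] with d (j+1) as a.e. derivative, and d k is in L^2(0,l). *)
Definition Hk_chain (k : nat) (l : R) (d : nat -> R -> C) : Prop :=
  L2 l (d 0%N) /\ L2 l (d k) /\
  (forall j : nat, (j < k)%N ->
     forall x, x \in `[0, l] -> d j x = d j 0 + cint 0 x (d j.+1)).

(* u in H~^k(G), with derivative data D (D e j = j-th derivative on edge e) *)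
Definition Hk_net (E : nat) (ell : 'I_E -> R) (k : nat)
  (u : 'I_E -> R -> C) (D : 'I_E -> nat -> R -> C) : Prop :=
  forall e, Hk_chain k (ell e) (D e) /\
            (forall x, x \in `[0, ell e] -> D e 0%N x = u e x).

Definition L2_net (E : nat) (ell : 'I_E -> R) (v : 'I_E -> R -> C) : Prop :=
  forall e, L2 (ell e) (v e).

(* C^{4E}, indexed by 'I_(E + E + (E + E)) (four blocks of size E). *)
Definition N4 (E : nat) : nat := (E + E + (E + E))%N.

Definition blocks4 (E : nat) (a b c d : 'rV[C]_E) : 'rV[C]_(N4 E) :=
  row_mx (row_mx a b) (row_mx c d).

Definition at0 (E : nat) (D : 'I_E -> nat -> R -> C) (j : nat) : 'rV[C]_E :=
  \row_(e < E) D e j 0.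
Definition atl (E : nat) (ell : 'I_E -> R) (D : 'I_E -> nat -> R -> C) (j : nat)
  : 'rV[C]_E := \row_(e < E) D e j (ell e).

(* u^{0,1} = (u(0), u(l), -u'(0), u'(l)) *)
Definition bv01 (E : nat) (ell : 'I_E -> R) (D : 'I_E -> nat -> R -> C) :=
  blocks4 (at0 D 0) (atl ell D 0) (- at0 D 1) (atl ell D 1).

(* u^{3,2} = (-u'''(0), u'''(l), -u''(0), -u''(l)) *)
Definition bv32 (E : nat) (ell : 'I_E -> R) (D : 'I_E -> nat -> R -> C) :=
  blocks4 (- at0 D 3) (atl ell D 3) (- at0 D 2) (- atl ell D 2).

(* standard inner product (x, y) = sum_i x_i conj(y_i) on C^n *)
Definition cdot (n : nat) (x y : 'rV[C]_n) : C := \sum_(i < n) x 0 i * (y 0 i)^*.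

(* Y is given as the row space of a square matrix; membership x \in Y *)
Definition inY (n : nat) (Y : 'M[C]_n) (x : 'rV[C]_n) : Prop := (x <= Y)%MS.

Definition inYperp (n : nat) (Y : 'M[C]_n) (x : 'rV[C]_n) : Prop :=
  forall y : 'rV[C]_n, (y <= Y)%MS -> cdot y x = 0.

(* L^2(G) inner product *)
Definition L2dot (E : nat) (ell : 'I_E -> R) (u v : 'I_E -> R -> C) : C :=
  \sum_(e < E) cint 0 (ell e) (fun x => u e x * (v e x)^*).

(* the form a(u,h), computed from derivative data; R acts on row vectors
   on the right: R x := x *m M. *)
Definition form_a (E : nat) (ell : 'I_E -> R) (M : 'M[C]_(N4 E))
  (Du Dh : 'I_E -> nat -> R -> C) : C :=
  \sum_(e < E) cint 0 (ell e) (fun x => Du e 2%N x * (Dh e 2%N x)^*)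
  - cdot (bv01 ell Du *m M) (bv01 ell Dh).

(* u in D(S), S the operator associated with a, and S u = v *)
Definition assoc_op_graph (E : nat) (ell : 'I_E -> R) (Y M : 'M[C]_(N4 E))
  (u v : 'I_E -> R -> C) : Prop :=
  L2_net ell v /\
  exists Du, Hk_net ell 2 u Du /\ inY Y (bv01 ell Du) /\
    forall h Dh, Hk_net ell 2 h Dh -> inY Y (bv01 ell Dh) ->
      form_a ell M Du Dh = L2dot ell v h.

(* u in D(A_{Y,R}) and A_{Y,R} u = v (v = u'''' a.e. on each edge) *)
Definition A_graph (E : nat) (ell : 'I_E -> R) (Y M : 'M[C]_(N4 E))
  (u v : 'I_E -> R -> C) : Prop :=
  L2_net ell v /\
  exists Du, Hk_net ell 4 u Du /\ inY Y (bv01 ell Du) /\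
    inYperp Y (bv32 ell Du + bv01 ell Du *m M) /\
    forall e, {ae mu, forall x, itv 0 (ell e) x -> v e x = Du e 4%N x}.

End Network.

(* Main.v *)
(* Integration by parts for primitives of integrable functions is Fubini's
   theorem on the square [0,l]^2 cut along its diagonal.  If u lies in the domain
   of the form operator and v is its image, solve q^(4) = v on each edge with the
   same values and first derivatives at the endpoints as u.  Then h = u - q has
   vanishing boundary values, hence is an admissible test function whatever Y is,
   and comparing a(u, h) = (v, h) with Green's formula for q gives
   int |h''|^2 = 0, i.e. u = q.  What remains of a(u, h) = (v, h) for general h is
   the boundary term, and cubic interpolation shows that h^{0,1} ranges over all
   of Y. *)
Require Import Defs.
From HB Require Import structures.
From mathcomp Require Import all_boot all_order all_algebra.
From mathcomp Require Import all_classical all_reals.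
From mathcomp Require Import topology normedtype sequences measure lebesgue_measure lebesgue_integral.
From mathcomp Require Import complex.
From mathcomp Require Import measurable_realfun ftc ereal.
From mathcomp Require Import ring lra.
Set Implicit Arguments.
Unset Strict Implicit.
Unset Printing Implicit Defensive.
Import Order.TTheory GRing.Theory Num.Theory.
Import numFieldNormedType.Exports.
Local Open Scope classical_set_scope.
Local Open Scope ring_scope.

(** * Primitives of integrable functions on [0, l] *)

Section RealPrimitives.
Variable R : realType.
Local Notation mu := (@lebesgue_measure R).
Local Notation filterS_ae := (@filterS _ _ (ae_filter_ringOfSetsType mu) _ _).
Implicit Types (f g F G : R -> R) (l : R).

(** By Tonelli the integral of the absolute value factors into the product of the two finite [L^1]
    norms. *)
Lemma integrable_prod f g :
  mu.-integrable setT (EFin \o f) -> mu.-integrable setT (EFin \o g) ->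
  (mu \x mu)%E.-integrable setT (fun z : R * R => (g z.1 * f z.2)%:E).
Proof.
move=> fi gi.
have /integrableP[/measurable_EFinP mf foo] := fi.
have /integrableP[/measurable_EFinP mg goo] := gi.
apply/integrable12ltyP.
  apply/measurable_EFinP; apply: measurable_funM.
    exact: (measurableT_comp mg measurable_fst).
  exact: (measurableT_comp mf measurable_snd).
have mnf : measurable_fun setT (fun x => `|f x|%:E).
  by apply/measurable_EFinP; exact: measurableT_comp.
have mng : measurable_fun setT (fun x => `|g x|%:E).
  by apply/measurable_EFinP; exact: measurableT_comp.
have E x : (\int[mu]_y `|(g x * f y)%:E| =
    `|g x|%:E * \int[mu]_y `|f y|%:E)%E.
  under eq_integral => y _ do rewrite /= normrM EFinM.
  by rewrite ge0_integralZl// => *; exact: normr_ge0.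
under eq_integral => x _ do rewrite E.
have f0 : (0 <= \int[mu]_y `|f y|%:E)%E.
  by apply: integral_ge0 => x _; exact: normr_ge0.
rewrite ge0_integralZr//.
have g0 : (0 <= \int[mu]_y `|g y|%:E)%E.
  by apply: integral_ge0 => x _; exact: normr_ge0.
by rewrite lte_mul_pinfty// ge0_fin_numE.
Qed.

(** Both terms on the left are iterated integrals of [f y * g x]: the first over the triangle
    [y <= x], the second, with its variables renamed, over [x < y]. Together they fill the
    square. *)
Lemma integral_primitive_swap l f g :
  mu.-integrable `[0, l] (EFin \o f) -> mu.-integrable `[0, l] (EFin \o g) ->
  \int[mu]_(x in `[0, l]) ((\int[mu]_(y in `[0, x]) f y) * g x) +
  \int[mu]_(x in `[0, l]) (f x * \int[mu]_(y in `[0, x]) g y) =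
  (\int[mu]_(x in `[0, l]) f x) * (\int[mu]_(x in `[0, l]) g x).
Proof.
move=> fi gi.
(* Extension by zero turns the square into the whole plane, where Fubini applies without side
   conditions on the domain. *)
set f0 := f \_ `[0, l]; set g0 := g \_ `[0, l].
have f0i : mu.-integrable setT (EFin \o f0).
  by rewrite -restrict_EFin; apply/integrable_restrict => //=; rewrite setTI.
have g0i : mu.-integrable setT (EFin \o g0).
  by rewrite -restrict_EFin; apply/integrable_restrict => //=; rewrite setTI.
pose H (z : R * R) := g0 z.1 * f0 z.2.
(* The diagonal is given to [K] alone, so [K + K'] equals [H] at every point. *)
pose K (z : R * R) := if z.2 <= z.1 then H z else 0.
pose K' (z : R * R) := if z.2 <= z.1 then 0 else H z.
have Hi : (mu \x mu)%E.-integrable setT (EFin \o H) by exact: integrable_prod.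
have /integrableP[/measurable_EFinP mH _] := Hi.
have mle : measurable_fun setT (fun z : R * R => z.2 <= z.1).
  by apply: measurable_fun_ler; [exact: measurable_snd|exact: measurable_fst].
have Ki : (mu \x mu)%E.-integrable setT (EFin \o K).
  apply: (le_integrable _ _ _ Hi) => //.
    by apply/measurable_EFinP; exact: measurable_fun_ifT.
  by move=> z _; rewrite /= lee_fin /K; case: ifP; rewrite ?normr0.
have K'i : (mu \x mu)%E.-integrable setT (EFin \o K').
  apply: (le_integrable _ _ _ Hi) => //.
    by apply/measurable_EFinP; exact: measurable_fun_ifT.
  by move=> z _; rewrite /= lee_fin /K'; case: ifP; rewrite ?normr0.
have HKK' : \int[(mu \x mu)%E]_z H z = \int[(mu \x mu)%E]_z K z + \int[(mu \x mu)%E]_z K' z.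
  rewrite -RintegralD//; apply: eq_Rintegral => z _.
  by rewrite /K /K'; case: ifP; rewrite ?addr0 ?add0r.
have K1 x : (\int[mu]_y (K (x, y))%:E =
    (((fun x => (\int[mu]_(y in `[0%R, x]) f y) * g x) \_ `[0%R, l]) x)%:E)%E.
  rewrite patchE; case: ifPn => [xl|xl]; last first.
    rewrite integral0_eq// => y _.
    by rewrite /K /H /= /g0 patchE (negbTE xl) mul0r; case: ifP.
  have xl' : x <= l by move: xl; rewrite inE/= in_itv/= => /andP[].
  have fx : mu.-integrable `[0, x] (EFin \o f).
    by apply: integrableS fi => //; apply: subset_itvl; rewrite bnd_simp.
  have E y : K (x, y) = (f \_ `[0, x]) y * g x.
    rewrite /K /H /= /g0 /f0 !patchE xl !mem_setE !in_itv/=.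
    case: (leP y x) => yx; case: (leP 0 y) => y0; rewrite ?mul0r ?mulr0//=.
    by rewrite (le_trans yx xl') mulrC.
  under eq_integral => y _ do rewrite E EFinM.
  have fx' : mu.-integrable setT (EFin \o (f \_ `[0, x])).
    by rewrite -restrict_EFin; apply/integrable_restrict => //=; rewrite setTI.
  rewrite integralZr//= EFinM /Rintegral fineK; last exact: integrable_fin_num.
  congr (_ * _)%E; rewrite [RHS]integral_mkcond.
  by apply: eq_integral => y _; rewrite restrict_EFin.
have K'1 y : (\int[mu]_x (K' (x, y))%:E =
    (((fun x => f x * (\int[mu]_(y in `[0%R, x]) g y)) \_ `[0%R, l]) y)%:E)%E.
  rewrite patchE; case: ifPn => [yl|yl]; last first.
    rewrite integral0_eq// => x _.
    by rewrite /K' /H /= /f0 patchE (negbTE yl) mulr0; case: ifP.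
  have yl' : y <= l by move: yl; rewrite inE/= in_itv/= => /andP[].
  have gy : mu.-integrable `[0, y] (EFin \o g).
    by apply: integrableS gi => //; apply: subset_itvl; rewrite bnd_simp.
  (* Since [K'] omits the diagonal, its slice at height [y] is half-open; the missing endpoint is
     restored below as a null set. *)
  have gy' : mu.-integrable `[0, y[ (EFin \o g).
    by apply: integrableS gy => //; apply: subset_itvl; rewrite bnd_simp.
  have E x : K' (x, y) = f y * (g \_ `[0, y[) x.
    rewrite /K' /H /= /g0 /f0 !patchE yl !mem_setE !in_itv/=.
    case: (leP y x) => yx; case: (leP 0 x) => x0; rewrite ?mul0r ?mulr0//=.
    by rewrite (le_trans (ltW yx) yl') mulrC.
  under eq_integral => x _ do rewrite E EFinM.
  have gx' : mu.-integrable setT (EFin \o (g \_ `[0, y[)).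
    by rewrite -restrict_EFin; apply/integrable_restrict => //=; rewrite setTI.
  rewrite integralZl//= EFinM -Rintegral_itv_bndo_bndc//.
  rewrite /Rintegral fineK; last exact: integrable_fin_num.
  congr (_ * _)%E; rewrite [RHS]integral_mkcond.
  by apply: eq_integral => x _; rewrite restrict_EFin.
have H1 x : (\int[mu]_y (H (x, y))%:E = (g0 x * \int[mu]_y f0 y)%:E)%E.
  under eq_integral => y _ do rewrite /H/= EFinM.
  by rewrite integralZl//= EFinM /Rintegral fineK//; exact: integrable_fin_num.
rewrite [X in X + _]Rintegral_mkcond [X in _ + X]Rintegral_mkcond.
rewrite [X in _ = X * _]Rintegral_mkcond [X in _ = _ * X]Rintegral_mkcond.
rewrite -/f0 -/g0 mulrC -RintegralZr//.
transitivity (\int[(mu \x mu)%E]_z H z); last first.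
  rewrite {1}/Rintegral -(integral12_prod_meas1 Hi).
  by congr fine; apply: eq_integral => x _; rewrite /fubini_F/= H1.
rewrite HKK'; congr (_ + _); rewrite {1}/Rintegral.
  rewrite [RHS]/Rintegral -(integral12_prod_meas1 Ki).
  by congr fine; apply: eq_integral => x _; rewrite /fubini_F/= K1.
rewrite [RHS]/Rintegral -(integral21_prod_meas1 K'i).
by congr fine; apply: eq_integral => x _; rewrite /fubini_G/= K'1.
Qed.
(** For integrable [f] this is absolute continuity of [F] with almost-everywhere derivative [f],
    kept in integral form so that no pointwise derivative is ever taken. *)
Definition primitive_on l F f :=
  forall x, x \in `[0, l] -> F x = F 0 + \int[mu]_(y in `[0, x]) f y.

Lemma primitive_on_continuous l F f : 0 <= l ->
  mu.-integrable `[0, l] (EFin \o f) -> primitive_on l F f ->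
  {within `[0, l], continuous F}.
Proof.
move=> l0 fi Ff.
have cI := parameterized_integral_continuous l0 fi.
have cF : {within `[0, l], continuous
    (fun x => F 0 + parameterized_integral mu 0 x f)}.
  by move=> x; apply: cvgD; [exact: cvg_cst|exact: cI].
apply: (subspace_eq_continuous _ cF) => x xl.
by rewrite /from_subspace (Ff x)//; move: xl; rewrite inE.
Qed.

Lemma integrable_cst l (k : R) : mu.-integrable `[0, l] (EFin \o cst k).
Proof.
apply: measurable_bounded_integrable => //.
  by rewrite /= lebesgue_measure_itv/=; case: ifP => // _; rewrite ltry.
by exists `|k|; split=> // M kM x _; exact: ltW.
Qed.

Lemma integrableS_itv l x f : x \in `[0, l] ->
  mu.-integrable `[0, l] (EFin \o f) -> mu.-integrable `[0, x] (EFin \o f).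
Proof.
rewrite in_itv/= => /andP[_ xl]; apply: integrableS => //.
by apply: subset_itvl; rewrite bnd_simp.
Qed.

Lemma primitive_on_integrable l F f : 0 <= l ->
  mu.-integrable `[0, l] (EFin \o f) -> primitive_on l F f ->
  mu.-integrable `[0, l] (EFin \o F).
Proof.
move=> l0 fi Ff; apply: continuous_compact_integrable.
  exact: segment_compact.
exact: primitive_on_continuous Ff.
Qed.

Lemma primitive_on_bounded l F f : 0 <= l ->
  mu.-integrable `[0, l] (EFin \o f) -> primitive_on l F f ->
  [bounded F x | x in `[0, l]].
Proof.
move=> l0 fi Ff; have cF : {within `[0, l], continuous (F : R -> R^o)}.
  exact: primitive_on_continuous Ff.
have /compact_bounded[M [_ FM]] := continuous_compact cF (@segment_compact _ _ _).
by exists M; split; rewrite ?num_real // => ? ? ? ?; exact: FM.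
Qed.

Lemma primitive_on_integrableM l F f g : 0 <= l ->
  mu.-integrable `[0, l] (EFin \o f) -> primitive_on l F f ->
  mu.-integrable `[0, l] (EFin \o g) ->
  mu.-integrable `[0, l] (EFin \o (fun x => F x * g x)).
Proof.
move=> l0 fi Ff gi.
have /integrableP[/measurable_EFinP mF _] := primitive_on_integrable l0 fi Ff.
have := integrableMr _ mF (primitive_on_bounded l0 fi Ff) gi.
by apply.
Qed.

Lemma primitive_on_parts l F f G g : 0 <= l ->
  mu.-integrable `[0, l] (EFin \o f) -> primitive_on l F f ->
  mu.-integrable `[0, l] (EFin \o g) -> primitive_on l G g ->
  \int[mu]_(x in `[0, l]) (F x * g x) =
  F l * G l - F 0 * G 0 - \int[mu]_(x in `[0, l]) (f x * G x).
Proof.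
move=> l0 fi Ff gi Gg.
have ll : l \in `[0, l] by rewrite in_itv/= l0 lexx.
(* [integral_primitive_swap] treats primitives vanishing at 0; the constants [F 0] and [G 0] are
   split off and integrated separately. *)
pose IF x := \int[mu]_(y in `[0, x]) f y.
pose IG x := \int[mu]_(y in `[0, x]) g y.
have IF0 : IF 0 = 0 by rewrite /IF set_itv1 Rintegral_set1.
have IG0 : IG 0 = 0 by rewrite /IG set_itv1 Rintegral_set1.
have IFf : primitive_on l IF f by move=> x _; rewrite IF0 add0r.
have IGg : primitive_on l IG g by move=> x _; rewrite IG0 add0r.
have -> : \int[mu]_(x in `[0, l]) (F x * g x) =
    F 0 * IG l + \int[mu]_(x in `[0, l]) (IF x * g x).
  rewrite -RintegralZl// -RintegralD//.
  - apply: eq_Rintegral => x; rewrite inE => xl.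
    by rewrite (Ff x)// mulrDl.
  - exact: (integrableZl _ _ gi).
  - exact: primitive_on_integrableM IFf gi.
have -> : \int[mu]_(x in `[0, l]) (f x * G x) =
    G 0 * IF l + \int[mu]_(x in `[0, l]) (f x * IG x).
  rewrite -RintegralZl// -RintegralD//.
  - apply: eq_Rintegral => x; rewrite inE => xl.
    by rewrite (Gg x)// mulrDr mulrC.
  - exact: (integrableZl _ _ fi).
  - have := primitive_on_integrableM l0 gi IGg fi.
    by apply: eq_integrable => // x _ /=; rewrite mulrC.
have := integral_primitive_swap fi gi.
rewrite (Ff l)// (Gg l)// -/(IF l) -/(IG l).
set A := Rintegral _ _ _; set B := Rintegral _ _ _; set IFl := IF l.
set IGl := IG l; move=> AB.
have -> : A = IFl * IGl - B by rewrite -AB addrK.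
ring.
Qed.

(** * Cubic polynomials and the fourth-order boundary value problem *)

Lemma Rintegral_itv_cst l (k : R) : 0 <= l ->
  \int[mu]_(x in `[0, l]) k = k * l.
Proof.
move=> l0; rewrite Rintegral_cst//= lebesgue_measure_itv/=.
case: ifPn; first by rewrite sube0.
rewrite lte_fin -leNgt => l0'.
by have -> : l = 0 by apply/le_anti/andP.
Qed.

Lemma primitive_on_id l : primitive_on l id (cst 1).
Proof.
move=> x; rewrite in_itv/= => /andP[x0 _].
by rewrite Rintegral_itv_cst// add0r mul1r.
Qed.

Lemma Rintegral_id l : 0 <= l -> \int[mu]_(x in `[0, l]) x = l ^+ 2 / 2.
Proof.
move=> l0.
have P := @primitive_on_id l.
(* Integrating [x * 1] by parts gives [I = l^2 - I]. *)
have := primitive_on_parts l0 (integrable_cst l 1) P (integrable_cst l 1) P.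
under eq_Rintegral do rewrite mulr1.
under [in RHS]eq_Rintegral do rewrite mul1r.
by set I := Rintegral _ _ _ => H; lra.
Qed.

Lemma Rintegral_sqr l : 0 <= l -> \int[mu]_(x in `[0, l]) (x ^+ 2) = l ^+ 3 / 3.
Proof.
move=> l0.
have i1 := integrable_cst l 1.
have P := @primitive_on_id l.
have iid := primitive_on_integrable l0 i1 P.
have P2 : primitive_on l (fun x => x ^+ 2) (fun x => 2 * x).
  move=> x xl; rewrite RintegralZl//; last exact: integrableS_itv iid.
  move: xl; rewrite in_itv/= => /andP[x0 _].
  by rewrite Rintegral_id//; field.
have i2 : mu.-integrable `[0, l] (EFin \o (fun x => 2 * x)).
  exact: (integrableZl _ _ iid).
have i3 := primitive_on_integrable l0 i2 P2.
(* Here integration by parts of [x^2 * 1] gives [I = l^3 - 2 I]. *)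
have := primitive_on_parts l0 i2 P2 i1 P.
under eq_Rintegral do rewrite mulr1.
under [in RHS]eq_Rintegral do rewrite -mulrA -expr2.
rewrite RintegralZl//.
by set I := Rintegral _ _ _ => H; lra.
Qed.

Lemma integrableD_itv l f g : mu.-integrable `[0, l] (EFin \o f) ->
  mu.-integrable `[0, l] (EFin \o g) ->
  mu.-integrable `[0, l] (EFin \o (fun x => f x + g x)).
Proof. by move=> fi gi; exact: (integrableD _ fi gi). Qed.

Lemma integrableZl_itv l k f : mu.-integrable `[0, l] (EFin \o f) ->
  mu.-integrable `[0, l] (EFin \o (fun x => k * f x)).
Proof. by move=> fi; exact: (integrableZl _ _ fi). Qed.

Lemma primitive_on_int l f :
  primitive_on l (fun x => \int[mu]_(y in `[0, x]) f y) f.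
Proof. by move=> x _; rewrite set_itv1 Rintegral_set1 add0r. Qed.

Lemma primitive_onD l F f G g :
  mu.-integrable `[0, l] (EFin \o f) -> primitive_on l F f ->
  mu.-integrable `[0, l] (EFin \o g) -> primitive_on l G g ->
  primitive_on l (fun x => F x + G x) (fun x => f x + g x).
Proof.
move=> fi Ff gi Gg x xl; rewrite (Ff x)// (Gg x)// RintegralD//; last 2 first.
  exact: integrableS_itv fi.
  exact: integrableS_itv gi.
by ring.
Qed.

(* Normalised so that differentiation shifts the coefficients. *)
Definition cubic (k0 k1 k2 k3 x : R) :=
  k0 + k1 * x + k2 * (x ^+ 2 / 2) + k3 * (x ^+ 3 / 6).

Lemma primitive_on_cubic l (k0 k1 k2 k3 : R) : 0 <= l ->
  mu.-integrable `[0, l] (EFin \o cubic k1 k2 k3 0) /\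
  primitive_on l (cubic k0 k1 k2 k3) (cubic k1 k2 k3 0).
Proof.
move=> l0.
have i1 := integrable_cst l 1.
have iid := primitive_on_integrable l0 i1 (@primitive_on_id l).
have isq : mu.-integrable `[0, l] (EFin \o (fun x => x * x)).
  exact: primitive_on_integrableM l0 i1 (@primitive_on_id l) iid.
have ik1 := integrable_cst l k1.
have ik2 : mu.-integrable `[0, l] (EFin \o (fun x => k2 * x)).
  exact: integrableZl_itv.
have ik3 : mu.-integrable `[0, l] (EFin \o (fun x => (k3 / 2) * (x * x))).
  exact: integrableZl_itv.
have ik12 : mu.-integrable `[0, l] (EFin \o (fun x => k1 + k2 * x)).
  exact: integrableD_itv.
have E x : cubic k1 k2 k3 0 x = k1 + k2 * x + (k3 / 2) * (x * x).
  by rewrite /cubic mul0r addr0; field.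
split.
  have := integrableD_itv ik12 ik3.
  by apply: eq_integrable => // x _ /=; rewrite E.
move=> x xl.
under eq_Rintegral do rewrite E.
rewrite RintegralD//; last 2 first.
  exact: integrableS_itv ik12.
  exact: integrableS_itv ik3.
rewrite RintegralD//; last 2 first.
  exact: integrableS_itv ik1.
  exact: integrableS_itv ik2.
rewrite !RintegralZl//; last 2 first.
  exact: integrableS_itv isq.
  exact: integrableS_itv iid.
move: xl; rewrite in_itv/= => /andP[x0 _].
under [X in (_ / _) * X]eq_Rintegral do rewrite -expr2.
by rewrite Rintegral_itv_cst// Rintegral_id// Rintegral_sqr// /cubic; field.
Qed.

(** The fourfold integral of [f] from 0 has the right fourth derivative, and adding a cubic does not
    change that. Hermite interpolation fits the four coefficients to the endpoint data; it is
    solvable because [l] is nonzero. *)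
Lemma fourth_order_bvp l f (a b c d : R) : 0 < l ->
  mu.-integrable `[0, l] (EFin \o f) ->
  exists q : nat -> R -> R, [/\ q 4%N = f,
    forall j, (j < 4)%N -> primitive_on l (q j) (q j.+1),
    q 0%N 0 = a /\ q 0%N l = b & q 1%N 0 = c /\ q 1%N l = d].
Proof.
move=> l0 fi; have l0' := ltW l0.
pose V1 x := \int[mu]_(y in `[0, x]) f y.
pose V2 x := \int[mu]_(y in `[0, x]) V1 y.
pose V3 x := \int[mu]_(y in `[0, x]) V2 y.
pose V4 x := \int[mu]_(y in `[0, x]) V3 y.
have i1 := primitive_on_integrable l0' fi (@primitive_on_int l f).
have i2 := primitive_on_integrable l0' i1 (@primitive_on_int l V1).
have i3 := primitive_on_integrable l0' i2 (@primitive_on_int l V2).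
(* The data at 0 force the coefficients [a] and [c]. The other two solve [be l + al l^2/2 = D] for
   the slope at [l] and [be l^2/2 + al l^3/6 = B] for the value at [l]. *)
pose D := d - c - V3 l; pose B := b - a - c * l - V4 l.
pose al := (6 * l * D - 12 * B) / l ^+ 3.
pose be := D / l - al * l / 2.
pose q (j : nat) : R -> R := match j with
  | 0%N => fun x => cubic a c be al x + V4 x
  | 1%N => fun x => cubic c be al 0 x + V3 x
  | 2%N => fun x => cubic be al 0 0 x + V2 x
  | 3%N => fun x => cubic al 0 0 0 x + V1 x
  | _ => f end.
have V0 h : \int[mu]_(y in `[0%R, 0%R]) h y = 0 :> R.
  by rewrite set_itv1 Rintegral_set1.
exists q; split=> //.
- have [P0 P1 P2 P3] := And4 (@primitive_on_cubic l a c be al l0')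
    (@primitive_on_cubic l c be al 0 l0') (@primitive_on_cubic l be al 0 0 l0')
    (@primitive_on_cubic l al 0 0 0 l0').
  case=> [|[|[|[|//]]]] _.
  + exact: (primitive_onD P0.1 P0.2 i3 (@primitive_on_int l V3)).
  + exact: (primitive_onD P1.1 P1.2 i2 (@primitive_on_int l V2)).
  + exact: (primitive_onD P2.1 P2.2 i1 (@primitive_on_int l V1)).
  (* At this level the differentiated cubic is zero and has to be removed from the integrand to
     leave [f] itself. *)
  + have := primitive_onD P3.1 P3.2 fi (@primitive_on_int l f).
    move=> H x xl; apply: etrans (H x xl) _; congr (_ + _); apply: eq_Rintegral => y _.
    by rewrite /cubic/= !mul0r !addr0 add0r.
- rewrite /= /cubic; split; first by rewrite /V4 V0; ring.
  by rewrite /be /al /D /B; field; rewrite lt0r_neq0.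
- rewrite /= /cubic; split; first by rewrite /V3 V0; ring.
  by rewrite /be /al /D /B; field; rewrite lt0r_neq0.
Qed.

(** * Square-integrable functions and almost-everywhere equality *)

Definition square_integrable l f :=
  measurable_fun `[0, l] f /\
  mu.-integrable `[0, l] (EFin \o (fun x => f x ^+ 2)).

(** The product is dominated through [|f g| <= f^2 + g^2]. *)
Lemma square_integrableM l f g : square_integrable l f ->
  square_integrable l g -> mu.-integrable `[0, l] (EFin \o (fun x => f x * g x)).
Proof.
move=> [mf if2] [mg ig2].
apply: (le_integrable _ _ _ (integrableD_itv if2 ig2)) => //.
  by apply/measurable_EFinP; exact: measurable_funM.
move=> x _; rewrite /= lee_fin [leRHS]ger0_norm ?addr_ge0 ?sqr_ge0//.
rewrite ler_norml; apply/andP; split; last by nra.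
by nra.
Qed.

Lemma square_integrable_cst l k : square_integrable l (cst k).
Proof. by split=> //; exact: (integrable_cst l (k ^+ 2)). Qed.

(** The interval is bounded, so the constant 1 is square integrable and can serve as the second
    factor. *)
Lemma square_integrable_integrable l f : square_integrable l f ->
  mu.-integrable `[0, l] (EFin \o f).
Proof.
move=> sf; have := square_integrableM sf (square_integrable_cst l 1).
by apply: eq_integrable => // x _ /=; rewrite mulr1.
Qed.

Lemma square_integrableB l f g : square_integrable l f ->
  square_integrable l g -> square_integrable l (fun x => f x - g x).
Proof.
move=> sf sg; have [[mf if2] [mg ig2]] := (sf, sg).
split; first exact: measurable_funB.
have := integrableD_itv (integrableD_itv if2 ig2)
  (integrableZl_itv (- 2) (square_integrableM sf sg)).
by apply: eq_integrable => // x _ /=; congr EFin; ring.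
Qed.

Lemma primitive_on_square_integrable l F f : 0 <= l ->
  mu.-integrable `[0, l] (EFin \o f) -> primitive_on l F f ->
  square_integrable l F.
Proof.
move=> l0 fi Ff; have Fi := primitive_on_integrable l0 fi Ff.
split; first by have /integrableP[/measurable_EFinP] := Fi.
have := primitive_on_integrableM l0 fi Ff Fi.
by apply: eq_integrable => // x _ /=; rewrite expr2.
Qed.

Lemma Rintegral_ae_eq l f g : mu.-integrable `[0, l] (EFin \o f) ->
  mu.-integrable `[0, l] (EFin \o g) ->
  {ae mu, forall x, x \in `[0, l] -> f x = g x} ->
  \int[mu]_(x in `[0, l]) f x = \int[mu]_(x in `[0, l]) g x.
Proof.
move=> /integrableP[mf _] /integrableP[mg _] fg.
congr fine; apply: ae_eq_integral => //.
by apply: (filterS_ae _ fg) => x fgx xl /=; rewrite fgx.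
Qed.

Lemma Rintegral_sqr_eq0 l f : square_integrable l f ->
  \int[mu]_(x in `[0, l]) (f x ^+ 2) = 0 ->
  {ae mu, forall x, x \in `[0, l] -> f x = 0}.
Proof.
move=> [mf if2] I0.
have /integrableP[mf2 _] := if2.
have /(ae_eq_integral_abs mu _ mf2) : 
    (\int[mu]_(x in `[0%R, l]) `|(EFin \o (fun x => f x ^+ 2)%R) x| = 0)%E.
  under eq_integral => x _ do rewrite /= ger0_norm ?sqr_ge0//.
  by rewrite -[LHS]fineK ?(integrable_fin_num _ if2)//; congr EFin.
move=> /(_ (measurable_itv _)) f0; apply: (filterS_ae _ f0) => x fx xl; have /= := fx xl => -[/eqP]; by rewrite sqrf_eq0 => /eqP.
Qed.

Lemma ae_itvS l x (P : R -> Prop) : x \in `[0, l] ->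
  {ae mu, forall y, y \in `[0, l] -> P y} ->
  {ae mu, forall y, y \in `[0, x] -> P y}.
Proof.
rewrite in_itv/= => /andP[_ xl] aeP; apply: (filterS_ae _ aeP) => y Py yx; apply: Py.
by move: yx; rewrite !in_itv/= => /andP[-> /le_trans->].
Qed.

End RealPrimitives.

(** * Complex-valued functions *)

Section ComplexPrimitives.
Variable R : realType.
Local Notation C := (R[i]).
Local Notation mu := (@lebesgue_measure R).
Local Notation filterS_ae := (@filterS _ _ (ae_filter_ringOfSetsType mu) _ _).
Local Notation Re := complex.Re.
Local Notation Im := complex.Im.
Implicit Types (f g F G u v w : R -> C) (l : R).

Lemma complex_ext (z w : C) : Re z = Re w -> Im z = Im w -> z = w.
Proof. by case: z w => [a b] [c d] /= -> ->. Qed.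

Lemma ReMconj (z w : C) : Re (z * w^*) = Re z * Re w + Im z * Im w.
Proof. by case: z w => [a b] [c d]; rewrite /= mulrN opprK. Qed.

Lemma ImMconj (z w : C) : Im (z * w^*) = Im z * Re w - Re z * Im w.
Proof. by case: z w => [a b] [c d]; rewrite /= mulrN addrC. Qed.

(** This is verbatim the link between consecutive derivatives in [Hk_chain], so the links of a chain
    can be used as they stand. *)
Definition cprimitive_on l F f :=
  forall x, x \in `[0, l] -> F x = F 0 + cint 0 x f.

Definition cintegrable l f :=
  mu.-integrable `[0, l] (EFin \o (fun x => Re (f x))) /\
  mu.-integrable `[0, l] (EFin \o (fun x => Im (f x))).

Lemma cprimitive_onP l F f : cprimitive_on l F f <->
  primitive_on l (fun x => Re (F x)) (fun x => Re (f x)) /\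
  primitive_on l (fun x => Im (F x)) (fun x => Im (f x)).
Proof.
split=> [Ff|[Fr Fi] x xl].
  by split=> x xl; rewrite Ff//= ; case: (F 0).
by apply: complex_ext; [rewrite Fr|rewrite Fi] => //; case: (F 0).
Qed.

Lemma eq_cint l f g : (forall x, x \in `[0, l] -> f x = g x) ->
  cint 0 l f = cint 0 l g.
Proof.
move=> fg; rewrite /cint; congr Complex; apply: eq_Rintegral => x;
by rewrite inE => xl; rewrite fg.
Qed.

Lemma cint_ae_eq l f g : cintegrable l f -> cintegrable l g ->
  {ae mu, forall x, x \in `[0, l] -> f x = g x} -> cint 0 l f = cint 0 l g.
Proof.
move=> [fr fi] [gr gi] fg; rewrite /cint; congr Complex;
by apply: Rintegral_ae_eq => //; apply: (filterS_ae _ fg) => x E xl; rewrite E.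
Qed.

Lemma cintB l f g : cintegrable l f -> cintegrable l g ->
  cint 0 l (fun x => f x - g x) = cint 0 l f - cint 0 l g.
Proof.
move=> [fr fi] [gr gi]; apply: complex_ext => /=.
  rewrite -RintegralB//; apply: eq_Rintegral => x _.
  by case: (f x) (g x) => [a b] [c d].
rewrite -RintegralB//; apply: eq_Rintegral => x _.
by case: (f x) (g x) => [a b] [c d].
Qed.

Lemma cprimitive_onB l F f G g : cintegrable l f -> cprimitive_on l F f ->
  cintegrable l g -> cprimitive_on l G g ->
  cprimitive_on l (fun x => F x - G x) (fun x => f x - g x).
Proof.
move=> [fr fi] Ff [gr gi] Gg x xl; rewrite cintB; last 2 first.
  by split; exact: integrableS_itv xl _.
  by split; exact: integrableS_itv xl _.
by rewrite (Ff x)// (Gg x)//; ring.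
Qed.

Lemma L2P l f : L2 l f <-> square_integrable l (fun x => Re (f x)) /\
  square_integrable l (fun x => Im (f x)).
Proof.
split=> [[mr [mi foo]]|[[mr ir] [mi ii]]].
  have mn : measurable_fun `[0, l] (fun x => normsq (f x)).
    by apply: measurable_funD; exact: measurable_funX.
  have ni : mu.-integrable `[0, l] (EFin \o (fun x => normsq (f x))).
    apply/integrableP; split; first exact/measurable_EFinP.
    under eq_integral => x _ do
      rewrite /= ger0_norm ?addr_ge0 ?sqr_ge0//.
    exact: foo.
  split; split=> //; apply: (le_integrable _ _ _ ni) => //.
  - by apply/measurable_EFinP; exact: measurable_funX.
  - move=> x _; rewrite /= lee_fin !ger0_norm ?addr_ge0 ?sqr_ge0//.
    by rewrite /normsq lerDl sqr_ge0.
  - by apply/measurable_EFinP; exact: measurable_funX.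
  - move=> x _; rewrite /= lee_fin !ger0_norm ?addr_ge0 ?sqr_ge0//.
    by rewrite /normsq lerDr sqr_ge0.
split=> //; split=> //.
have /integrableP[_] := integrableD_itv ir ii.
under eq_integral => x _ do
  rewrite /= ger0_norm ?addr_ge0 ?sqr_ge0//.
exact.
Qed.

Lemma L2_cintegrable l f : L2 l f -> cintegrable l f.
Proof. by move/L2P => [fr fi]; split; exact: square_integrable_integrable. Qed.

Lemma L2B l f g : L2 l f -> L2 l g -> L2 l (fun x => f x - g x).
Proof.
move=> /L2P[fr fi] /L2P[gr gi]; apply/L2P; split.
  have := square_integrableB fr gr; congr square_integrable.
  by apply/funext => x; case: (f x) (g x) => [a b] [c d].
have := square_integrableB fi gi; congr square_integrable.
by apply/funext => x; case: (f x) (g x) => [a b] [c d].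
Qed.

Lemma L2_mulconj l f g : L2 l f -> L2 l g ->
  cintegrable l (fun x => f x * (g x)^*).
Proof.
move=> /L2P[fr fi] /L2P[gr gi]; split.
  have := integrableD_itv (square_integrableM fr gr) (square_integrableM fi gi).
  by apply: eq_integrable => // x _ /=; rewrite ReMconj.
have := integrableD_itv (square_integrableM fi gr)
  (integrableZl_itv (- 1) (square_integrableM fr gi)).
by apply: eq_integrable => // x _ /=; rewrite ImMconj mulN1r.
Qed.

(** A primitive is continuous on a compact interval, hence bounded. This places the intermediate
    derivatives of a chain in [L2], although [Hk_chain] asks it only of the lowest and the
    highest. *)
Lemma cprimitive_on_L2 l F f : 0 <= l -> cintegrable l f ->
  cprimitive_on l F f -> L2 l F.
Proof.
move=> l0 [fr fi] /cprimitive_onP[Fr Fi]; apply/L2P.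
by split; [exact: primitive_on_square_integrable fr Fr|
           exact: primitive_on_square_integrable fi Fi].
Qed.

Lemma cprimitive_on_integrable l F f : 0 <= l -> cintegrable l f ->
  cprimitive_on l F f -> cintegrable l F.
Proof. by move=> l0 fi Ff; apply/L2_cintegrable/(cprimitive_on_L2 l0 fi Ff). Qed.

(** * Green's formula and weak fourth derivatives on one edge *)

Lemma cint_parts l F f G g : 0 <= l ->
  cintegrable l f -> cprimitive_on l F f ->
  cintegrable l g -> cprimitive_on l G g ->
  cint 0 l (fun x => F x * (g x)^*) =
  F l * (G l)^* - F 0 * (G 0)^* - cint 0 l (fun x => f x * (G x)^*).
Proof.
move=> l0 [fr fi] /cprimitive_onP[Fr Fi] [gr gi] /cprimitive_onP[Gr Gi].
have swap h k : mu.-integrable `[0, l] (EFin \o (fun x => h x * k x)) ->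
    mu.-integrable `[0, l] (EFin \o (fun x => k x * h x)).
  by apply: eq_integrable => // x _ /=; rewrite mulrC.
have Frgr := primitive_on_integrableM l0 fr Fr gr.
have Frgi := primitive_on_integrableM l0 fr Fr gi.
have Figr := primitive_on_integrableM l0 fi Fi gr.
have Figi := primitive_on_integrableM l0 fi Fi gi.
have frGr := swap _ _ (primitive_on_integrableM l0 gr Gr fr).
have frGi := swap _ _ (primitive_on_integrableM l0 gi Gi fr).
have fiGr := swap _ _ (primitive_on_integrableM l0 gr Gr fi).
have fiGi := swap _ _ (primitive_on_integrableM l0 gi Gi fi).
(* The real and imaginary parts of [F * conj g] each reduce to two real integrations by parts. *)
apply: complex_ext.
  rewrite !raddfB/=.
  under eq_Rintegral do rewrite ReMconj.
  under [in RHS]eq_Rintegral do rewrite ReMconj.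
  rewrite !RintegralD// (primitive_on_parts l0 fr Fr gr Gr).
  rewrite (primitive_on_parts l0 fi Fi gi Gi).
  rewrite !ReMconj; ring.
rewrite !raddfB/=.
under eq_Rintegral do rewrite ImMconj.
under [in RHS]eq_Rintegral do rewrite ImMconj.
rewrite !RintegralB// (primitive_on_parts l0 fi Fi gr Gr).
rewrite (primitive_on_parts l0 fr Fr gi Gi).
rewrite !ImMconj; ring.
Qed.

(** Two integrations by parts. The boundary terms are grouped and signed as the contribution of one
    edge to the pairing of [bv32] with [bv01]. *)
Lemma cint_green l q2 q3 f h0 h1 h2 : 0 <= l ->
  cintegrable l f -> cprimitive_on l q3 f -> cprimitive_on l q2 q3 ->
  cintegrable l h2 -> cprimitive_on l h1 h2 -> cprimitive_on l h0 h1 ->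
  cint 0 l (fun x => q2 x * (h2 x)^*) =
  cint 0 l (fun x => f x * (h0 x)^*)
  - (- q3 0 * (h0 0)^* + q3 l * (h0 l)^* + q2 0 * (h1 0)^* - q2 l * (h1 l)^*).
Proof.
move=> l0 fi q3f q2q3 h2i h1h2 h0h1.
have q3i := cprimitive_on_integrable l0 fi q3f.
have h1i := cprimitive_on_integrable l0 h2i h1h2.
rewrite (cint_parts l0 q3i q2q3 h2i h1h2) (cint_parts l0 fi q3f h1i h0h1).
by ring.
Qed.

Lemma fourth_order_cbvp l f (a b c d : C) : 0 < l -> cintegrable l f ->
  exists q : nat -> R -> C, [/\ q 4%N = f,
    forall j, (j < 4)%N -> cprimitive_on l (q j) (q j.+1),
    q 0%N 0 = a /\ q 0%N l = b & q 1%N 0 = c /\ q 1%N l = d].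
Proof.
move=> l0 [fr fi].
have [p [p4 pP [p00 p0l] [p10 p1l]]] :=
  fourth_order_bvp (Re a) (Re b) (Re c) (Re d) l0 fr.
have [r [r4 rP [r00 r0l] [r10 r1l]]] :=
  fourth_order_bvp (Im a) (Im b) (Im c) (Im d) l0 fi.
exists (fun j x => Complex (p j x) (r j x)); split.
- by apply/funext => x; apply: complex_ext; rewrite /= ?p4 ?r4.
- by move=> j j4; apply/cprimitive_onP; split; [exact: pP|exact: rP].
- by split; apply: complex_ext.
- by split; apply: complex_ext.
Qed.

(** New derivative data [q] are produced because [u2] is determined only up to a null set: agreement
    at order two holds almost everywhere, while at orders zero and one it is pointwise on the
    interval. *)
Lemma weak_fourth_derivative l (u0 u1 u2 v : R -> C) : 0 < l ->
  L2 l v -> L2 l u2 -> cprimitive_on l u1 u2 -> cprimitive_on l u0 u1 ->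
  (forall h : nat -> R -> C, Hk_chain 2 l h ->
    h 0%N 0 = 0 -> h 0%N l = 0 -> h 1%N 0 = 0 -> h 1%N l = 0 ->
    cint 0 l (fun x => u2 x * (h 2%N x)^*) =
    cint 0 l (fun x => v x * (h 0%N x)^*)) ->
  exists q : nat -> R -> C, [/\ q 4%N = v,
    forall j, (j < 4)%N -> cprimitive_on l (q j) (q j.+1),
    {in `[0, l], q 0%N =1 u0}, {in `[0, l], q 1%N =1 u1} &
    {ae mu, forall x, x \in `[0, l] -> q 2%N x = u2 x}].
Proof.
move=> l0 Lv Lu2 u1u2 u0u1 weak; have l0' := ltW l0.
have vi := L2_cintegrable Lv; have u2i := L2_cintegrable Lu2.
have u1i := cprimitive_on_integrable l0' u2i u1u2.
have [q [q4 qP [q00 q0l] [q10 q1l]]] :=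
  fourth_order_cbvp (u0 0) (u0 l) (u1 0) (u1 l) l0 vi.
have q34 := qP 3%N isT; rewrite q4 in q34.
have q23 := qP 2%N isT; have q12 := qP 1%N isT; have q01 := qP 0%N isT.
have q3i := cprimitive_on_integrable l0' vi q34.
have Lq2 := cprimitive_on_L2 l0' q3i q23.
have q2i := L2_cintegrable Lq2.
have q1i := cprimitive_on_integrable l0' q2i q12.
pose h (j : nat) : R -> C := match j with
  | 0%N => fun x => u0 x - q 0%N x
  | 1%N => fun x => u1 x - q 1%N x
  | _ => fun x => u2 x - q 2%N x end.
have h01 : cprimitive_on l (h 0%N) (h 1%N) by exact: cprimitive_onB.
have h12 : cprimitive_on l (h 1%N) (h 2%N) by exact: cprimitive_onB.
have Lh2 : L2 l (h 2%N) by exact: L2B.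
have h2i := L2_cintegrable Lh2.
have h1i := cprimitive_on_integrable l0' h2i h12.
have Lh0 := cprimitive_on_L2 l0' h1i h01.
have h00 : h 0%N 0 = 0 by rewrite /= q00 subrr.
have h0l : h 0%N l = 0 by rewrite /= q0l subrr.
have h10 : h 1%N 0 = 0 by rewrite /= q10 subrr.
have h1l : h 1%N l = 0 by rewrite /= q1l subrr.
have chain : Hk_chain 2 l h by split=> //; split=> // -[|[|//]] _.
(* The weak equation and Green's formula for [q] have the same right-hand side, so subtracting them
   leaves the integral of [(u2 - q2) * conj h2], that is of [|h2|^2], equal to zero. *)
have := weak h chain h00 h0l h10 h1l.
have := cint_green l0' vi q34 q23 h2i h12 h01.
rewrite h00 h0l h10 h1l conjC0 !mulr0 !addr0 !subr0 => <- /eqP.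
rewrite -subr_eq0 -cintB; [|exact: L2_mulconj|exact: L2_mulconj].
have -> : cint 0 l (fun x => u2 x * (h 2%N x)^* - q 2%N x * (h 2%N x)^*) =
    cint 0 l (fun x => h 2%N x * (h 2%N x)^*).
  by apply: eq_cint => x _; rewrite /= mulrBl.
(* The real part is a sum of two integrals of squares, so each of them vanishes. *)
move=> /eqP /(congr1 (@Re R)) /=.
under eq_Rintegral do rewrite ReMconj.
have /L2P[hr hi] := Lh2.
rewrite RintegralD//; [|exact: square_integrableM|exact: square_integrableM].
under eq_Rintegral do rewrite -expr2.
under [X in _ + X]eq_Rintegral do rewrite -expr2.
move/eqP; rewrite paddr_eq0; try by apply: Rintegral_ge0 => x _; exact: sqr_ge0.
move=> /andP[/eqP /(Rintegral_sqr_eq0 hr) hr0 /eqP /(Rintegral_sqr_eq0 hi) hi0].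
have qu : {ae mu, forall x, x \in `[0, l] -> q 2%N x = u2 x}.
  apply: (@filterS2 _ _ (ae_filter_ringOfSetsType mu) _ _ _ _ hr0 hi0).
  move=> x /= hrx hix xl; apply/esym/subr0_eq.
  by apply: complex_ext; [exact: hrx|exact: hix].
(* Equal values at 0 and almost equal integrands give equal primitives; the same argument then
   descends to order zero. *)
have q1u1 : {in `[0, l], q 1%N =1 u1}.
  move=> x xl; rewrite (u1u2 x xl) (q12 x xl) q10; congr (_ + _).
  have [[? ?] [? ?]] := (u2i, q2i).
  apply: cint_ae_eq.
  - by split; exact: integrableS_itv xl _.
  - by split; exact: integrableS_itv xl _.
  - exact: ae_itvS xl qu.
exists q; split=> //.
move=> x xl; rewrite (u0u1 x xl) (q01 x xl) q00; congr (_ + _).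
apply: eq_cint => y yx; apply: q1u1.
by move: xl yx; rewrite !in_itv/= => /andP[_ xl] /andP[-> /le_trans->].
Qed.

End ComplexPrimitives.

(** * Networks *)

Section Networks.
Variables (R : realType) (E : nat).
Local Notation C := (R[i]).
Local Notation mu := (@lebesgue_measure R).
Implicit Types (ell : 'I_E -> R) (D : 'I_E -> nat -> R -> C).

Lemma cdotDl n (x y z : 'rV[C]_n) : cdot (x + y) z = cdot x z + cdot y z.
Proof.
by rewrite /cdot -big_split; apply: eq_bigr => i _; rewrite mxE mulrDl.
Qed.

Lemma cdot0r n (x : 'rV[C]_n) : cdot x 0 = 0.
Proof. by rewrite /cdot big1// => i _; rewrite mxE conjC0 mulr0. Qed.

Lemma cdot_conj n (x y : 'rV[C]_n) : (cdot x y)^* = cdot y x.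
Proof.
by rewrite /cdot rmorph_sum; apply: eq_bigr => i _; rewrite rmorphM/= conjCK mulrC.
Qed.

(** Regrouping the blocks by edge allows a comparison with Green's formula edge by edge. *)
Lemma cdot_blocks4 (a b c d a' b' c' d' : 'rV[C]_E) :
  cdot (blocks4 a b c d) (blocks4 a' b' c' d') =
  \sum_e (a 0 e * (a' 0 e)^* + b 0 e * (b' 0 e)^* +
          c 0 e * (c' 0 e)^* + d 0 e * (d' 0 e)^*).
Proof.
rewrite /cdot !big_split_ord/= -!big_split/=; apply: eq_bigr => e _.
by rewrite /blocks4 !(row_mxEl, row_mxEr) !addrA.
Qed.

Lemma blocks4_surj (y : 'rV[C]_(N4 E)) : exists a b c d, y = blocks4 a b c d.
Proof.
pose y' : 'rV[C]_(E + E + (E + E)) := y.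
exists (lsubmx (lsubmx y')), (rsubmx (lsubmx y')),
  (lsubmx (rsubmx y')), (rsubmx (rsubmx y')).
by rewrite /blocks4 !hsubmxK.
Qed.

(** * Green's formula on the network and surjectivity of the boundary map *)

Definition fourth_chain ell D := forall e,
  cintegrable (ell e) (D e 4%N) /\
  forall j, (j < 4)%N -> cprimitive_on (ell e) (D e j) (D e j.+1).

(** The boundary terms of Green's formula and the [M] term of the form are both paired with
    [bv01 ell Dh], so they merge into the vector that the boundary condition requires to be
    orthogonal to [Y]. *)
Lemma form_a_green ell (M : 'M[C]_(N4 E)) Du h Dh :
  (forall e, 0 < ell e) -> fourth_chain ell Du -> Hk_net ell 2 h Dh ->
  form_a ell M Du Dh = L2dot ell (fun e => Du e 4%N) h
    - cdot (bv32 ell Du + bv01 ell Du *m M) (bv01 ell Dh).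
Proof.
move=> ell0 uchain hchain.
rewrite /form_a cdotDl opprD addrA; congr (_ - _).
rewrite /bv32 /bv01 cdot_blocks4 /L2dot -sumrB; apply: eq_bigr => e _.
have [u4 uP] := uchain e.
have [[_ [/L2_cintegrable h2 hP]] h0] := hchain e.
rewrite (cint_green (ltW (ell0 e)) u4 (uP 3%N isT) (uP 2%N isT) h2
  (hP 1%N isT) (hP 0%N isT)).
congr (_ - _).
  by apply: eq_cint => x xl; rewrite h0.
(* In the third block the minus signs of [-u''(0)] and [-h'(0)] cancel. *)
by rewrite !mxE rmorphN/= mulrNN !mulNr.
Qed.

Lemma boundary_value_surj ell (y : 'rV[C]_(N4 E)) : (forall e, 0 < ell e) ->
  exists D, Hk_net ell 2 (fun e => D e 0%N) D /\ bv01 ell D = y.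
Proof.
move=> ell0; have [a [b [c [d ->]]]] := blocks4_surj y.
have z e : cintegrable (ell e) (fun=> 0).
  by split; exact: integrable_cst.
(* With right-hand side zero the solution is the cubic interpolant. The sign of [c] is reversed
   because the third block records minus the derivative at 0. *)
have /choice[D DP] e := fourth_order_cbvp (a 0 e) (b 0 e) (- c 0 e) (d 0 e)
  (ell0 e) (z e).
exists D; split=> [e|].
  have [D4 DD _ _] := DP e; have l0 := ltW (ell0 e).
  have D3i := cprimitive_on_integrable l0 (z e) (eq_ind _ _ (DD 3%N isT) _ D4).
  have D2i := cprimitive_on_integrable l0 D3i (DD 2%N isT).
  have D1i := cprimitive_on_integrable l0 D2i (DD 1%N isT).
  split=> //; split; first exact: cprimitive_on_L2 D1i (DD 0%N isT).
  split; first exact: cprimitive_on_L2 D3i (DD 2%N isT).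
  by move=> j j2; apply: DD; exact: leq_trans j2 _.
rewrite /bv01; congr (blocks4 _ _ _ _); apply/rowP => e; rewrite !mxE;
by have [_ _ [D00 D0l] [D10 D1l]] := DP e; rewrite ?D00 ?D0l ?D10 ?D1l ?opprK.
Qed.

(** * The form operator against the differential operator *)

Lemma L2_zero l : L2 l (fun=> 0 : C).
Proof. by apply/L2P; split; exact: square_integrable_cst. Qed.

Lemma cint_zero l : cint 0 l (fun=> 0 : C) = 0.
Proof. by apply: complex_ext; rewrite /= Rintegral_cst// mul0r. Qed.

(* A test function supported on a single edge with vanishing boundary values
   lies in the form domain whatever Y is. *)
Lemma assoc_op_weak_edge ell (Y M : 'M[C]_(N4 E)) v Du :
  (forall h Dh, Hk_net ell 2 h Dh -> inY Y (bv01 ell Dh) ->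
    form_a ell M Du Dh = L2dot ell v h) ->
  forall e (h : nat -> R -> C), Hk_chain 2 (ell e) h ->
    h 0%N 0 = 0 -> h 0%N (ell e) = 0 -> h 1%N 0 = 0 -> h 1%N (ell e) = 0 ->
    cint 0 (ell e) (fun x => Du e 2%N x * (h 2%N x)^*) =
    cint 0 (ell e) (fun x => v e x * (h 0%N x)^*).
Proof.
move=> weak e h hchain h00 h0l h10 h1l.
pose Dh e' j := if e' == e then h j else (fun=> 0 : C).
have DhP : Hk_net ell 2 (fun e' => Dh e' 0%N) Dh.
  move=> e'; split=> //; rewrite /Dh; case: eqP => [->//|_].
  split; first exact: L2_zero.
  by split=> [|j j2 x xl]; [exact: L2_zero|rewrite cint_zero addr0].
have bv0 : bv01 ell Dh = 0.
  have E0 j : h j 0 = 0 -> at0 Dh j = 0.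
    by move=> hj; apply/rowP => e'; rewrite !mxE /Dh; case: eqP.
  have El j : h j (ell e) = 0 -> atl ell Dh j = 0.
    by move=> hj; apply/rowP => e'; rewrite !mxE /Dh; case: eqP => [->|].
  by rewrite /bv01 !E0// !El// oppr0 /blocks4 !row_mx0.
have := weak _ _ DhP; rewrite bv0 => /(_ (sub0mx _ _)).
rewrite /form_a bv0 cdot0r subr0 /L2dot.
(* Both sums over the edges collapse to the edge [e], since the test function is zero on the
   others. *)
rewrite (bigD1 e)//= [in RHS](bigD1 e)//= /Dh eqxx.
rewrite big1 ?addr0; last first.
  move=> e' /negbTE ->; rewrite -[RHS](cint_zero (ell e')).
  by apply: eq_cint => x _; rewrite /= conjC0 mulr0.
rewrite big1 ?addr0//.
move=> e' /negbTE ->; rewrite -[RHS](cint_zero (ell e')).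
by apply: eq_cint => x _; rewrite /= conjC0 mulr0.
Qed.

Lemma assoc_op_A_graph ell (Y M : 'M[C]_(N4 E)) u v : (forall e, 0 < ell e) ->
  assoc_op_graph ell Y M u v -> A_graph ell Y M u v.
Proof.
move=> ell0 [Lv [Du [uchain [uY weak]]]].
have edge e : exists q : nat -> R -> C, [/\ q 4%N = v e,
    forall j, (j < 4)%N -> cprimitive_on (ell e) (q j) (q j.+1),
    {in `[0, ell e], q 0%N =1 Du e 0%N}, {in `[0, ell e], q 1%N =1 Du e 1%N} &
    {ae mu, forall x, x \in `[0, ell e] -> q 2%N x = Du e 2%N x}].
  have [[_ [L2u uP]] _] := uchain e.
  apply: weak_fourth_derivative (ell0 e) (Lv e) L2u (uP 1%N isT) (uP 0%N isT) _.
  exact: assoc_op_weak_edge weak e.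
(* [Du] is constrained only up to order two; the fourth-order witness for [u] is assembled from the
   edgewise solutions [q]. *)
have /choice[q qP] := edge.
have in0 e : 0 \in `[0, ell e] by rewrite in_itv/= lexx ltW.
have inl e : ell e \in `[0, ell e] by rewrite in_itv/= lexx ltW.
(* Only orders zero and one at the endpoints enter, and there the agreement is pointwise. *)
have bvq : bv01 ell q = bv01 ell Du.
  rewrite /bv01; congr (blocks4 _ _ (- _) _); apply/rowP => e; rewrite !mxE;
  by have [_ _ q0 q1 _] := qP e; rewrite ?q0 ?q1.
have qchain : fourth_chain ell q.
  move=> e; have [q4 qe _ _ _] := qP e; split=> //.
  by rewrite q4; exact: L2_cintegrable (Lv e).
have L2q e : L2 (ell e) (q e 2%N).
  have [q4i qe] := qchain e.
  have q3i := cprimitive_on_integrable (ltW (ell0 e)) q4i (qe 3%N isT).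
  exact: cprimitive_on_L2 (ltW (ell0 e)) q3i (qe 2%N isT).
split=> //; exists q; split; last split; last split.
- move=> e; have [q4 qe q0 _ _] := qP e; have [[L0u [_ _]] u0] := uchain e.
  split; last by move=> x xl; rewrite q0// u0.
  split; last by rewrite q4.
  have [q4i _] := qchain e; have l0 := ltW (ell0 e).
  have q3i := cprimitive_on_integrable l0 q4i (qe 3%N isT).
  have q2i := cprimitive_on_integrable l0 q3i (qe 2%N isT).
  have q1i := cprimitive_on_integrable l0 q2i (qe 1%N isT).
  exact: cprimitive_on_L2 l0 q1i (qe 0%N isT).
- by rewrite bvq.
(* A vector [y] of [Y] is realised as the boundary value of a test function [D]. The weak equation
   cancels the integral terms in Green's formula, leaving the pairing with [y] equal to zero. *)
- move=> y yY; rewrite -cdot_conj.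
  have [D [DP Dy]] := boundary_value_surj y ell0.
  have := form_a_green M ell0 qchain DP; rewrite Dy.
  (* The form sees order two only under the integral, so almost-everywhere agreement suffices. *)
  have <- : form_a ell M Du D = form_a ell M q D.
    rewrite /form_a bvq; congr (_ - _); apply: eq_bigr => e _.
    have [_ _ _ _ q2] := qP e.
    have [[_ [L2u _]] _] := uchain e; have [[_ [L2D _]] _] := DP e.
    apply: cint_ae_eq; [exact: L2_mulconj|exact: L2_mulconj|].
    by apply: (@filterS _ _ (ae_filter_ringOfSetsType mu) _ _ _ q2) => x qx xl;
      rewrite qx.
  rewrite (weak _ _ DP); last by rewrite /inY Dy.
  have -> : L2dot ell v (fun e => D e 0%N) =
      L2dot ell (fun e => q e 4%N) (fun e => D e 0%N).
    by apply: eq_bigr => e _; have [-> _ _ _ _] := qP e.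
  by move=> /eqP; rewrite eq_sym subr_eq addrC -subr_eq subrr => /eqP <-; rewrite conjC0.
- by move=> e; have [-> _ _ _ _] := qP e; exact: aeW.
Qed.

(** Green's formula applies to [Du] directly: its boundary pairing vanishes by orthogonality to [Y],
    and the fourth derivative is replaced by [v] almost everywhere. *)
Lemma A_graph_assoc_op ell (Y M : 'M[C]_(N4 E)) u v : (forall e, 0 < ell e) ->
  A_graph ell Y M u v -> assoc_op_graph ell Y M u v.
Proof.
move=> ell0 [Lv [Du [uchain [uY [uperp vu4]]]]].
have chain4 : fourth_chain ell Du.
  by move=> e; have [[_ [/L2_cintegrable u4 uP]] _] := uchain e.
split=> //; exists Du; split.
  move=> e; have [[L0u [_ uP]] u0] := uchain e; have [u4 _] := chain4 e.
  have l0 := ltW (ell0 e).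
  (* Truncating the chain to order two requires the second derivative in [L2]; it is a primitive of
     the integrable third derivative. *)
  have u3 := cprimitive_on_integrable l0 u4 (uP 3%N isT).
  split=> //; split=> //; split; first exact: cprimitive_on_L2 l0 u3 (uP 2%N isT).
  by move=> j j2; apply: uP; exact: leq_trans j2 _.
split=> // h Dh hP hY.
rewrite (form_a_green M ell0 chain4 hP) -cdot_conj uperp// conjC0 subr0.
apply: eq_bigr => e _; have [[L0h [_ _]] h0] := hP e.
have [[_ [L4u _]] _] := uchain e.
(* The [L2] hypothesis concerns [Dh e 0], which agrees with [h e] on the edge. *)
have hE w : cint 0 (ell e) (fun x => w x * (h e x)^*) =
    cint 0 (ell e) (fun x => w x * (Dh e 0%N x)^*).
  by apply: eq_cint => x xl; rewrite h0.
rewrite !hE.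
apply: cint_ae_eq; [exact: L2_mulconj|exact: L2_mulconj (Lv e) L0h|].
apply: (@filterS _ _ (ae_filter_ringOfSetsType mu) _ _ _ (vu4 e)) => x vx xl.
by rewrite vx.
Qed.

End Networks.

Theorem theorem4p3 (R : realType) (V : finType) (E : nat)
  (src tgt : 'I_E -> V) (ell : 'I_E -> R)
  (Y M : 'M[R[i]]_(N4 E)) :
  simple_connected_graph src tgt ->
  (forall e, 0 < ell e) ->
  stablemx Y M ->
  forall (u v : 'I_E -> R -> R[i]),
    assoc_op_graph ell Y M u v <-> A_graph ell Y M u v.
Proof.
move=> _ ell0 _ u v; split; first exact: assoc_op_A_graph.
exact: A_graph_assoc_op.
Qed.
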